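(* Let $n\ge2$. A half-area $2n$-polygon $\gamma$ is odd-symmetric if and only if its discrete envelope $\mathcal{E}$ reduces to a point, i.e. all the points $\mathcal{E}(i+\tfrac12)$, $1\le i\le 2n$, coincide.
   Context: Indices are taken modulo $2n$. A convex $2n$-polygon is given by $2n$ distinct points $\gamma(1),\dots,\gamma(2n)\in\mathbb{R}^2$, listed in cyclic order along the boundary of a convex polygonal region with nonempty interior whose boundary is the union of the sides $\gamma(i)\gamma(i+1)$ (collinear consecutive vertices are allowed). It is a half-area polygon if, for every $i$, the line $l(i)$ through $\gamma(i)$ and $\gamma(i+n)$ divides the region into two parts of equal area. The discrete envelope $\mathcal{E}$ is the polygon with vertices $\mathcal{E}(i+\tfrac12)=l(i)\cap l(i+1)$ (a single point). Let $\lambda(i+\tfrac12)=\dfrac{|\gamma(i+n)-\gamma(i+1)|}{|\gamma(i+n+1)-\gamma(i)|}$ be the ratio of the lengths of the central diagonals $\gamma(i+1)\gamma(i+n)$ and $\gamma(i)\gamma(i+n+1)$. The polygon is odd-symmetric if there is a constant $c>0$ such that $\lambda(i+\tfrac12)=c$ for $i$ odd and $\lambda(i+\tfrac12)=\tfrac1c$ for $i$ even ($1\le i\le 2n$); the case $c=1$ is allowed. *)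

(* Defs.v *)
From HB Require Import structures.
From mathcomp Require Import all_boot all_order all_algebra.
From mathcomp Require Import all_classical all_reals all_analysis.
Import Order.TTheory GRing.Theory Num.Theory.
Import numFieldNormedType.Exports.

Set Implicit Arguments.
Unset Strict Implicit.
Unset Printing Implicit Defensive.

Local Open Scope classical_set_scope.
Local Open Scope ring_scope.

(* The plane is R * R.  Its library norm is the sup norm, so the Euclidean
   distance is spelled out; its topology and its Borel sets are the usual ones. *)
Definition eucl_dist (R : realType) (p q : R * R) : R :=
  Num.sqrt ((p.1 - q.1) ^+ 2 + (p.2 - q.2) ^+ 2).

Definition area (R : realType) (A : set (R * R)) : \bar R :=
  (lebesgue_measure \x lebesgue_measure)%E A.

Definition line (R : realType) (p q : R * R) : set (R * R) :=
  [set p + t *: (q - p) | t in [set: R]].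

Definition side (R : realType) (p q : R * R) : set (R * R) :=
  [set p + t *: (q - p) | t in `[0, 1]].

Definition half_open_side (R : realType) (p q : R * R) : set (R * R) :=
  [set p + t *: (q - p) | t in `[0, 1[].

(* For p != q, the sign of this determinant tells on which side of the line
   through p and q the point x lies. *)
Definition orient (R : realType) (p q x : R * R) : R :=
  (q.1 - p.1) * (x.2 - p.2) - (q.2 - p.2) * (x.1 - p.1).

Definition boundary (T : topologicalType) (A : set T) : set T :=
  closure A `\` interior A.

Section polygon.
Variables (R : realType) (n : nat).

(* Vertex indices live in 'Z_(2 * n), which is Z/2nZ as soon as 0 < n. *)
Variable gamma : 'Z_(2 * n) -> R * R.

Implicit Types i j : 'Z_(2 * n).

(* The closed convex region bounded by the polygon is the convex hull of the
   vertices. *)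
Definition region : set (R * R) :=
  [set x | exists w : 'Z_(2 * n) -> R,
    [/\ forall i, 0 <= w i, \sum_i w i = 1 & x = \sum_i w i *: gamma i]].

(* Disjointness of the half-open sides says that running through the sides
   traverses the boundary exactly once, i.e. that the vertices are listed in
   cyclic order; without it, several vertices on one edge of the region could
   be listed in a back-and-forth order. *)
Definition convex_polygon : Prop :=
  [/\ injective gamma,
      interior region !=set0,
      boundary region = \bigcup_i side (gamma i) (gamma (i + 1)) &
      forall i j, i != j ->
        half_open_side (gamma i) (gamma (i + 1)) `&`
        half_open_side (gamma j) (gamma (j + 1)) = set0].

Definition diagonal i : set (R * R) := line (gamma i) (gamma (i + n%:R)).

Definition half_area_polygon : Prop :=
  convex_polygon /\
  forall i,
    area (region `&` [set x | 0 < orient (gamma i) (gamma (i + n%:R)) x]) =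
    area (region `&` [set x | orient (gamma i) (gamma (i + n%:R)) x < 0]).

(* The vertex E(i + 1/2) of the discrete envelope, as a subset of the plane. *)
Definition envelope_vertex i : set (R * R) := diagonal i `&` diagonal (i + 1).

Definition envelope_is_point : Prop :=
  exists O : R * R, forall i, envelope_vertex i = [set O].

(* lambda i stands for lambda(i + 1/2). *)
Definition lambda i : R :=
  eucl_dist (gamma (i + n%:R)) (gamma (i + 1)) /
  eucl_dist (gamma (i + n%:R + 1)) (gamma i).

(* The parity of a residue is that of its representative in [0, 2n - 1], which
   agrees with that of its representative in [1, 2n] as 2n is even. *)
Definition odd_symmetric : Prop :=
  exists c : R, 0 < c /\ forall i, lambda i = if odd i then c else c^-1.

End polygon.

(* Main.v *)
Require Import Defs.
From mathcomp Require Import all_boot all_order all_algebra.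
From mathcomp Require Import all_classical all_reals all_analysis.
From mathcomp Require Import measurable_realfun zify ring lra.
Import Order.TTheory GRing.Theory Num.Theory.
Import numFieldNormedType.Exports.
Set Implicit Arguments.
Unset Strict Implicit.
Unset Printing Implicit Defensive.
Local Open Scope classical_set_scope.
Local Open Scope ring_scope.

(** Two consecutive bisecting chords, with endpoints a, c and b, d, cross at an
interior point E, and the two opposite angular sectors they cut out along the
sides ab and cd have equal area, because each chord halves the region.  The
region fills each of those sectors exactly up to the side, so they are the
triangles Eab and Ecd.  Writing c - E = - alpha (a - E) and
d - E = - beta (b - E), the second triangle is the image of the first under an
affine map of determinant alpha beta; hence alpha beta = 1
([bisecting_chords]).  Therefore abcd is a trapezoid whose diagonals meet at E
([trapezoid]): ad and bc are parallel, and their length ratio, which is lambda,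
equals alpha, the ratio in which E divides both chords ([chords_meet]).

The rest is bookkeeping with ratios: both properties of the theorem say that
lambda (i + 1/2) lambda (i + 3/2) = 1 for all i.  For odd-symmetry this is the
alternation of c and 1/c.  For the envelope, the chord from gamma (i + 1) to
gamma (i + n + 1) is divided by E (i + 1/2) in the ratio lambda (i + 1/2) and by
E (i + 3/2) in the ratio 1 / lambda (i + 3/2), so the two points agree exactly
when these ratios do ([odd_symmetricP], [envelope_is_pointP]).

Two ingredients need work.  One is the effect of affine maps on planar area
([area_affine]), obtained from Fubini and the affine behaviour of Lebesgue
measure on the line.  The other is the combinatorics of the polygon: a line that
halves the area has points of the region on both sides, so it meets the
boundary only at its two vertices ([boundary_chord]); hence the vertices between
them stay on one side, and consecutive chords really cross
([neighbours_opposite], [ends_opposite]). *)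

(* The measurable structure of the line is attached to the copy
   measurableTypeR R of R, and so is the product structure of the plane. *)
Local Notation plane R := (measurableTypeR R * measurableTypeR R)%type.

(** * Planar area under affine maps *)

(** Lebesgue measure is determined by its values on intervals, where the scaling
factor can be read off. *)
Lemma lebesgue_measure_affine (R : realType) (p r : R) (A : set (measurableTypeR R)) :
  p != 0 -> measurable A ->
  lebesgue_measure ((fun x => p * x + r) @^-1` A)
    = (`|p|^-1%:E * lebesgue_measure A)%E.
Proof.
move=> p0 mA; have p_gt0 : 0 < `|p| by rewrite normr_gt0.
have p_ge0 := ltW p_gt0.
pose f : measurableTypeR R -> measurableTypeR R := fun x => p * x + r.
have mf : measurable_fun setT f.
  apply: measurable_funD; last exact: measurable_cst.
  by apply: measurable_funM; [exact: measurable_cst|exact: measurable_id].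
suff -> : lebesgue_measure A = (`|p|%:E * lebesgue_measure (f @^-1` A))%E.
  by rewrite muleA -EFinM mulVf ?gt_eqF// mul1e.
apply: (@lebesgue_measure_unique R
  (mscale (NngNum p_ge0) (pushforward lebesgue_measure f))) => //= _ [[a b]] _ <-.
rewrite /mscale/= /pushforward lebesgue_measure_itv/= lte_fin.
have [p_pos|p_neg] : 0 < p \/ p < 0 by apply/orP; rewrite -neq_lt eq_sym.
- have -> : f @^-1` `]a, b] = `](a - r) / p, (b - r) / p]%classic.
    apply/seteqP; split=> x /=; rewrite !in_itv/= /f ler_pdivlMr// ltr_pdivrMr//;
      lra.
  rewrite lebesgue_measure_itv/= lte_fin ltr_pM2r ?invr_gt0// ltrD2r.
  case: ifPn => _; last by rewrite mule0.
  by rewrite -!EFinD -EFinM gtr0_norm//; congr EFin; field.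
- have -> : f @^-1` `]a, b] = `[(b - r) / p, (a - r) / p[%classic.
    apply/seteqP; split=> x /=; rewrite !in_itv/= /f ler_ndivrMr// ltr_ndivlMr//;
      lra.
  rewrite lebesgue_measure_itv/= lte_fin ltr_nM2r ?invr_lt0// ltrD2r.
  case: ifPn => _; last by rewrite mule0.
  by rewrite -!EFinD -EFinM ltr0_norm//; congr EFin; field.
Qed.

(** The map acts on each vertical section as an affine map of the line, with a
scaling factor that is the same for all sections. *)
Lemma area_vertical_affine (R : realType) (p q r : R) (A : set (plane R)) :
  p != 0 -> measurable A ->
  area ((fun x => (x.1, p * x.2 + (q * x.1 + r))) @^-1` A)
    = (`|p|^-1%:E * area A)%E.
Proof.
move=> p0 mA; rewrite /area/= /product_measure1.
rewrite -ge0_integralZl//; last exact: measurable_fun_xsection.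
apply: eq_integral => x _ /=.
rewrite -(lebesgue_measure_affine (q * x + r))//.
exact: measurable_xsection.
Qed.

Lemma area_swap (R : realType) (A : set (plane R)) : measurable A ->
  area ((fun x => (x.2, x.1)) @^-1` A) = area A.
Proof.
move=> mA; apply/esym.
apply: (@product_measure_unique _ _ _ _ _ lebesgue_measure lebesgue_measure
  (pushforward (lebesgue_measure \x lebesgue_measure)%E (fun x => (x.2, x.1)))) => //=.
  exact: measurable_swap.
move=> mswap B C mB mC; rewrite /pushforward.
have -> : (fun x => (x.2, x.1)) @^-1` (B `*` C) = C `*` B.
  by apply/seteqP; split=> -[x y] [].
by rewrite muleC; exact: product_measure1E.
Qed.

Lemma measurable_affine2 (R : realType) (p q r : R) :
  measurable_fun setT (fun x : plane R => p * x.1 + q * x.2 + r).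
Proof.
apply: measurable_funD; last exact: measurable_cst.
by apply: measurable_funD; apply: measurable_funM;
  [exact: measurable_cst|exact: measurable_fst|
   exact: measurable_cst|exact: measurable_snd].
Qed.

Lemma area_horizontal_affine (R : realType) (p q r : R) (A : set (plane R)) :
  p != 0 -> measurable A ->
  area ((fun x => (p * x.1 + (q * x.2 + r), x.2)) @^-1` A)
    = (`|p|^-1%:E * area A)%E.
Proof.
move=> p0 mA.
have mswap : measurable ((fun x => (x.2, x.1)) @^-1` A : set (plane R)).
  by rewrite -[X in measurable X]setTI; exact: measurable_swap.
rewrite -[in RHS]area_swap// -(area_vertical_affine q r)// -[RHS]area_swap//.
rewrite -[X in measurable X]setTI.
have mf : measurable_fun setT
    (fun x : plane R => (x.1, p * x.2 + (q * x.1 + r)) : plane R).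
  apply: measurable_fun_pair; first exact: measurable_fst.
  under eq_fun do rewrite addrA [p * _ + _]addrC.
  exact: measurable_affine2.
exact: mf.
Qed.

(** When m11 is nonzero the map is a horizontal affine map followed by a vertical
one, whose factors multiply to the determinant. *)
Lemma area_affine (R : realType) (m11 m12 k1 m21 m22 k2 : R) (A : set (plane R)) :
  m11 * m22 - m12 * m21 != 0 -> measurable A ->
  area ((fun x => (m11 * x.1 + m12 * x.2 + k1, m21 * x.1 + m22 * x.2 + k2)) @^-1` A)
    = (`|m11 * m22 - m12 * m21|^-1%:E * area A)%E.
Proof.
have mpre (p q r p' q' r' : R) (B : set (plane R)) : measurable B ->
    measurable ((fun x : plane R =>
      (p * x.1 + q * x.2 + r, p' * x.1 + q' * x.2 + r') : plane R) @^-1` B).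
  move=> mB; rewrite -[X in measurable X]setTI.
  have mf : measurable_fun setT (fun x : plane R =>
      (p * x.1 + q * x.2 + r, p' * x.1 + q' * x.2 + r') : plane R).
    by apply: measurable_fun_pair; exact: measurable_affine2.
  exact: mf.
have nz (a b c d k l : R) (B : set (plane R)) : a * d - b * c != 0 -> a != 0 ->
    measurable B ->
    area ((fun x => (a * x.1 + b * x.2 + k, c * x.1 + d * x.2 + l)) @^-1` B)
      = (`|a * d - b * c|^-1%:E * area B)%E.
  move=> det0 a0 mB.
  pose p := (a * d - b * c) / a.
  have p0 : p != 0 by rewrite mulf_neq0// invr_eq0.
  have -> : a * d - b * c = a * p by rewrite /p; field.
  rewrite normrM invfM EFinM -muleA -(area_vertical_affine (c / a) (l - c / a * k))//.
  rewrite -(area_horizontal_affine b k)//.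
    congr area; apply/seteqP; split=> x /=;
      congr B; (congr pair; [ring|rewrite /p; field; exact: a0]).
  have := mpre 1 0 0 (c / a) p (l - c / a * k) B mB.
  congr measurable; apply/seteqP; split=> x /=;
      congr B; (congr pair; ring).
have [->|a0] := eqVneq m11 0; last by move=> d0; exact: nz.
rewrite mul0r sub0r oppr_eq0 mulf_eq0 negb_or => /andP[b0 c0] mA.
(* m11 = 0: precomposing with the area-preserving shear (x, y) |-> (x, y + x)
   makes the top left coefficient equal to m12, which is nonzero. *)
set S := (fun x => _).
have mS : measurable (S @^-1` A : set (plane R)) by exact: mpre.
have <- : area ((fun x => (x.1, 1 * x.2 + (1 * x.1 + 0))) @^-1` (S @^-1` A)) =
    area (S @^-1` A).
  by rewrite area_vertical_affine ?oner_eq0// normr1 invr1 mul1e.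
have := @nz m12 m12 (m21 + m22) m22 k1 k2 A.
have -> : m12 * m22 - m12 * (m21 + m22) = - (m12 * m21) by ring.
rewrite normrN => <-//; last by rewrite oppr_eq0 mulf_neq0.
by congr area; apply/seteqP; split=> x /=; congr A; congr pair => /=; ring.
Qed.

(** * Measurable sets and their area *)

Lemma nbhs_boxP (R : realType) (x : R * R) (A : set (R * R)) :
  nbhs x A <-> exists2 e, 0 < e &
    forall y, `|y.1 - x.1| < e -> `|y.2 - x.2| < e -> A y.
Proof.
split.
  move=> /nbhs_ballP[e /= e0 eA]; exists e => // y y1 y2.
  by apply: eA; split; rewrite -ball_normE/= distrC.
move=> [e e0 eA]; apply/nbhs_ballP; exists e => //= y [y1 y2].
by apply: eA; [move: y1|move: y2]; rewrite -ball_normE/= distrC.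
Qed.

Lemma area_ge0 (R : realType) (A : set (R * R)) : (0 <= area A)%E.
Proof. exact: measure_ge0. Qed.

Lemma le_area (R : realType) (A B : set (plane R)) :
  measurable A -> measurable B -> A `<=` B -> (area A <= area B)%E.
Proof.
move=> mA mB AB.
by apply: (@le_measure _ _ _ (lebesgue_measure \x lebesgue_measure)%E);
  rewrite ?inE.
Qed.

Lemma area_setU (R : realType) (A B : set (plane R)) :
  measurable A -> measurable B -> A `&` B = set0 ->
  area (A `|` B) = (area A + area B)%E.
Proof. by move=> mA mB AB; rewrite [LHS]measureU. Qed.

Lemma area0 (R : realType) : area (set0 : set (R * R)) = 0%E.
Proof. exact: measure0. Qed.

Definition open_box (R : realType) (x : R * R) (e : R) : set (plane R) :=
  [set y | `|y.1 - x.1| < e /\ `|y.2 - x.2| < e].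

Lemma open_boxE (R : realType) (x : R * R) (e : R) :
  open_box x e = `]x.1 - e, x.1 + e[ `*` `]x.2 - e, x.2 + e[.
Proof.
by apply/seteqP; split=> y /=; rewrite /open_box/= !in_itv/= !ltr_distl => -[].
Qed.

Lemma measurable_open_box (R : realType) (x : R * R) (e : R) :
  measurable (open_box x e).
Proof. by rewrite open_boxE; apply: measurableX; exact: measurable_itv. Qed.

Lemma area_open_box (R : realType) (x : R * R) (e : R) : 0 < e ->
  area (open_box x e) = ((2 * e) ^+ 2)%:E.
Proof.
move=> e0; rewrite open_boxE /area.
rewrite [LHS](@product_measure1E _ _ _ _ _ lebesgue_measure lebesgue_measure);
  [|exact: measurable_itv..].
rewrite /= !lebesgue_measure_itv/= !lte_fin !ifT; [|lra..].
by rewrite -!EFinD -EFinM; congr EFin; ring.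
Qed.

(** The plane has a countable base of boxes with rational centre and radius. *)
Lemma open_measurable2 (R : realType) (A : set (R * R)) :
  open A -> measurable (A : set (plane R)).
Proof.
move=> oA.
pose box (q : rat * rat * rat) : set (plane R) :=
  open_box (ratr q.1.1, ratr q.1.2) (ratr q.2).
pose F (q : rat * rat * rat) := if `[< box q `<=` A >] then box q else set0.
suff -> : A = \bigcup_q F q.
  apply: countable_bigcupT_measurable => // q; rewrite /F.
  by case: asboolP => _; [exact: measurable_open_box|exact: measurable0].
apply/seteqP; split=> [x Ax|x [q _]]; last first.
  by rewrite /F; case: asboolP => // bA; exact: bA.
have /nbhs_boxP[d d0 dA] : nbhs x A by exact: open_nbhs_nbhs.
(* Radius below d / 2: a box of radius e that contains x lies within distance
   2 e < d of x. *)
have [e] : exists e, ratr e \in `]0, d / 2[ by apply: rat_in_itvoo; lra.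
rewrite in_itv/= => /andP[e0 ed].
have [u] : exists u, ratr u \in `]x.1 - ratr e, x.1 + ratr e[.
  by apply: rat_in_itvoo; lra.
have [v] : exists v, ratr v \in `]x.2 - ratr e, x.2 + ratr e[.
  by apply: rat_in_itvoo; lra.
rewrite !in_itv/= => v_ u_.
exists (u, v, e) => //; rewrite /F; case: asboolP => [_|[]].
  by split=> /=; rewrite ltr_distlC.
move=> y [/=]; rewrite !ltr_norml => y1 y2.
by apply: dA; rewrite ltr_norml; lra.
Qed.

Lemma area_gt0 (R : realType) (A : set (R * R)) (x : R * R) :
  measurable (A : set (plane R)) -> nbhs x A -> (0 < area A)%E.
Proof.
move=> mA /nbhs_boxP[e e0 eA].
apply: (@lt_le_trans _ _ (area (open_box x e))).
  by rewrite area_open_box// lte_fin exprn_gt0// mulr_gt0.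
apply: le_area => //; first exact: measurable_open_box.
by move=> y [y1 y2]; exact: eA.
Qed.

Lemma area_bounded (R : realType) (A : set (R * R)) (M : R) :
  measurable (A : set (plane R)) ->
  (forall x, A x -> `|x.1| < M /\ `|x.2| < M) -> (area A < +oo)%E.
Proof.
move=> mA AM.
have [M0|M0] := leP M 0.
  have -> : A = set0.
    by rewrite -subset0 => x /AM[]; have := normr_ge0 x.1; lra.
  by rewrite area0.
apply: (@le_lt_trans _ _ (area (open_box (0, 0) M))).
  apply: le_area => //; first exact: measurable_open_box.
  by move=> y Ay; rewrite /open_box/= !subr0; exact: AM.
by rewrite area_open_box// ltry.
Qed.

Lemma measurable_affine_eq0 (R : realType) (p q r : R) :
  measurable ([set x | p * x.1 + q * x.2 + r = 0] : set (plane R)).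
Proof.
rewrite -[X in measurable X]setTI.
exact: (@measurable_affine2 R p q r measurableT [set 0] (measurable_set1 0)).
Qed.

Lemma measurable_affine_gt0 (R : realType) (p q r : R) :
  measurable ([set x | 0 < p * x.1 + q * x.2 + r] : set (plane R)).
Proof.
rewrite -[X in measurable X]setTI.
have := @measurable_affine2 R p q r measurableT `]0, +oo[%classic (measurable_itv _).
by congr measurable; apply/seteqP; split=> x /=; rewrite in_itv/= ?andbT.
Qed.

(** A rotation and dilation with matrix rows (p, q) and (- q, p) sends the line to
a vertical one, which is a product with a null factor. *)
Lemma area_line (R : realType) (p q r : R) : p ^+ 2 + q ^+ 2 != 0 ->
  area [set x | p * x.1 + q * x.2 + r = 0] = 0.
Proof.
move=> pq0.
have m0 : measurable ([set 0] `*` setT : set (plane R)).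
  by apply: measurableX; [exact: measurable_set1|exact: measurableT].
have pq : p * p - q * - q != 0 by rewrite mulrN opprK -!expr2.
have := area_affine r 0 pq m0.
rewrite [X in (_ * X)%E](@product_measure1E _ _ _ _ _ lebesgue_measure lebesgue_measure)//.
rewrite /= lebesgue_measure_set1 mul0e mule0 => <-.
by congr area; apply/seteqP; split=> x /=; [|case].
Qed.

(** * Convex sets in the plane *)

Section Plane.
Context {R : realType}.
Implicit Types (K : set (R * R)) (a b c d p q u v w x y E : R * R).

Definition convex_in_plane K :=
  forall x y t, K x -> K y -> 0 <= t <= 1 -> K (x + t *: (y - x)).

Lemma plane_eq p q : p.1 = q.1 -> p.2 = q.2 -> p = q.
Proof. by case: p q => [? ?] [? ?] /= -> ->. Qed.

Lemma triangle_sub K E u v s t : convex_in_plane K ->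
  K E -> K (E + u) -> K (E + v) -> 0 <= s -> 0 <= t -> s + t <= 1 ->
  K (E + s *: u + t *: v).
Proof.
move=> cK KE Ku Kv s0 t0 st1.
have [st0|st_gt0] := leP (s + t) 0.
  have [-> ->] : s = 0 /\ t = 0 by split; lra.
  by rewrite !scale0r !addr0.
have stn0 : s + t != 0 by rewrite gt_eqF.
have Km : K ((E + u) + (t / (s + t)) *: ((E + v) - (E + u))).
  apply: cK => //; rewrite divr_ge0 ?(ltW st_gt0)//= ler_pdivrMr//; lra.
have /(cK _ _ _ KE Km) : 0 <= s + t <= 1 by lra.
by congr K; apply: plane_eq; rewrite /= /GRing.scale/=; field.
Qed.

(** The orientations of x with respect to the sides, divided by that of the whole
triangle, are its barycentric coordinates. *)
Lemma mem_triangle K u v w x : convex_in_plane K -> K u -> K v -> K w ->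
  0 < orient u v w -> 0 <= orient u v x -> 0 <= orient v w x ->
  0 <= orient w u x -> K x.
Proof.
move=> cK Ku Kv Kw D0 x1 x2 x3; set D := orient u v w in D0.
have Dn0 : D != 0 by rewrite gt_eqF.
have := @triangle_sub K u (v - u) (w - u) (orient w u x / D) (orient u v x / D).
rewrite ![u + (_ - u)]addrC !subrK.
have -> : u + orient w u x / D *: (v - u) + orient u v x / D *: (w - u) = x.
  by apply: plane_eq; rewrite /= /GRing.scale/=; move: Dn0;
    rewrite /D /orient => Dn0; field.
apply=> //; [by rewrite divr_ge0// ltW..|].
rewrite -mulrDl ler_pdivrMr// mul1r -subr_ge0.
by move: x2; congr (0 <= _); rewrite /D /orient; ring.
Qed.

Lemma orientC u v x : orient v u x = - orient u v x.
Proof. by rewrite /orient; ring. Qed.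

Lemma continuous_orient u v : continuous (orient u v).
Proof.
move=> x; rewrite /orient; apply: cvgB; apply: cvgM; try exact: cvg_cst.
- by apply: cvgB; [exact: cvg_snd|exact: cvg_cst].
- by apply: cvgB; [exact: cvg_fst|exact: cvg_cst].
Qed.

Lemma nbhs_orient_gt0 u v x : 0 < orient u v x ->
  \forall y \near x, 0 < orient u v y.
Proof.
move=> ux; have := @continuous_orient u v x.
by move=> /(_ [set r | 0 < r]); apply; exact: lt_nbhsr.
Qed.

(** Points near the open segment uv lie in one of the triangles uvp and vuq,
according to their side of the line uv. *)
Lemma interior_middle K u v p q t : convex_in_plane K ->
  K u -> K v -> K p -> K q -> 0 < orient u v p -> orient u v q < 0 ->
  0 < t < 1 -> interior K (u + t *: (v - u)).
Proof.
move=> cK Ku Kv Kp Kq up uq /andP[t0 t1]; rewrite /interior/=.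
set m := u + _.
have vpm : 0 < orient v p m.
  have -> : orient v p m = (1 - t) * orient u v p.
    by rewrite /m /orient /= /GRing.scale/=; ring.
  by rewrite mulr_gt0// subr_gt0.
have pum : 0 < orient p u m.
  have -> : orient p u m = t * orient u v p.
    by rewrite /m /orient /= /GRing.scale/=; ring.
  by rewrite mulr_gt0.
have qvm : 0 < orient q v m.
  have -> : orient q v m = (1 - t) * - orient u v q.
    by rewrite /m /orient /= /GRing.scale/=; ring.
  by rewrite mulr_gt0// ?subr_gt0// oppr_gt0.
have uqm : 0 < orient u q m.
  have -> : orient u q m = t * - orient u v q.
    by rewrite /m /orient /= /GRing.scale/=; ring.
  by rewrite mulr_gt0// oppr_gt0.
near=> x.
have [ux|ux] := leP 0 (orient u v x).
  by apply: (@mem_triangle K u v p) => //; apply: ltW; near: x;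
    exact: nbhs_orient_gt0.
apply: (@mem_triangle K v u q) => //; rewrite ?[orient v u _]orientC ?oppr_gt0//;
  by [rewrite oppr_ge0 ltW | apply: ltW; near: x; exact: nbhs_orient_gt0].
Unshelve. all: by end_near. Qed.

(** Of three distinct collinear points of K, the middle one would be interior,
since K also has points on both sides of the line. *)
Lemma interior_collinear_middle K u v y p q :
  convex_in_plane K -> u != v -> K u -> K v -> K y -> K p -> K q ->
  ~ interior K u -> ~ interior K v -> ~ interior K y ->
  0 < orient u v p -> orient u v q < 0 -> orient u v y = 0 -> y = u \/ y = v.
Proof.
move=> cK uv Ku Kv Ky Kp Kq iu iv iy up uq uvy.
have [t yE] : exists t, y = u + t *: (v - u).
  have [u1|u1] := eqVneq (v.1 - u.1) 0.
    have u2 : v.2 - u.2 != 0.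
      apply: contra uv; rewrite subr_eq0 => /eqP u2; apply/eqP.
      by apply: plane_eq => //; apply/eqP; rewrite eq_sym -subr_eq0 u1.
    exists ((y.2 - u.2) / (v.2 - u.2)).
    apply: plane_eq; rewrite /= /GRing.scale/=; last by field.
    move: uvy; rewrite /orient u1 mul0r sub0r mulr0 addr0 => /eqP.
    by rewrite oppr_eq0 mulf_eq0 (negbTE u2)/= subr_eq0 => /eqP.
  exists ((y.1 - u.1) / (v.1 - u.1)).
  apply: plane_eq; rewrite /= /GRing.scale/=; first by field.
  apply: (mulfI u1); rewrite mulrDr mulrA mulrCA divff// mulr1.
  by move: uvy; rewrite /orient; lra.
have [t0|t0|t0] := ltgtP t 0; last by left; rewrite yE t0 scale0r addr0.
- (* u lies between y and v *)
  case: iu.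
  have t1 : 1 - t != 0 by rewrite gt_eqF//; lra.
  have -> : u = y + (- t / (1 - t)) *: (v - y).
    by rewrite yE; apply: plane_eq; rewrite /= /GRing.scale/=; field.
  have oE x : orient y v x = (1 - t) * orient u v x.
    by rewrite yE /orient /= /GRing.scale/=; ring.
  apply: (interior_middle cK Ky Kv Kp Kq); rewrite ?oE.
  + by rewrite mulr_gt0//; lra.
  + by rewrite pmulr_rlt0//; lra.
  + by rewrite divr_gt0 ?ltr_pdivrMr; lra.
have [t1|t1|t1] := ltgtP t 1; last by right; rewrite yE t1 scale1r addrC subrK.
- by case: iy; rewrite yE; apply: (interior_middle cK Ku Kv Kp Kq) => //; lra.
- case: iv.
  have tn0 : t != 0 by rewrite gt_eqF.
  have -> : v = u + t^-1 *: (y - u).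
    by rewrite yE; apply: plane_eq; rewrite /= /GRing.scale/=; field.
  have oE x : orient u y x = t * orient u v x.
    by rewrite yE /orient /= /GRing.scale/=; ring.
  apply: (interior_middle cK Ku Ky Kp Kq); rewrite ?oE.
  + by rewrite mulr_gt0.
  + by rewrite pmulr_rlt0.
  + by rewrite invr_gt0 t0 invf_lt1.
Qed.

(** The homothety of centre x and ratio 1 - t sends a neighbourhood of E that is
contained in K to a neighbourhood of the given point. *)
Lemma interior_star K E x t : convex_in_plane K ->
  interior K E -> K x -> 0 <= t < 1 -> interior K (E + t *: (x - E)).
Proof.
rewrite /interior/= => cK /nbhs_boxP[e e0 eK] Kx /andP[t0 t1].
have t'0 : 0 < 1 - t by lra.
have t'n0 : 1 - t != 0 by rewrite gt_eqF.
apply/nbhs_boxP; exists ((1 - t) * e); first by rewrite mulr_gt0.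
move=> y y1 y2.
set m := E + t *: (x - E) in y1 y2 *.
have Kz : K (E + (1 - t)^-1 *: (y - m)).
  apply: eK; rewrite /= /GRing.scale/= addrC addKr normrM normfV (gtr0_norm t'0)//;
    by rewrite ltr_pdivrMl.
have := cK _ _ t Kz Kx; rewrite t0 (ltW t1) => /(_ isT).
by congr K; apply: plane_eq; rewrite /m /= /GRing.scale/=; field.
Qed.

(** A point of K beyond the chord joining E + u to E + v would put a point of that
chord strictly between itself and the interior point E, hence in the interior. *)
Lemma convex_wedge K E u v s t : convex_in_plane K -> interior K E ->
  K (E + u) -> K (E + v) ->
  (forall r, 0 <= r <= 1 -> ~ interior K (E + u + r *: ((E + v) - (E + u)))) ->
  0 < s -> 0 < t -> K (E + s *: u + t *: v) <-> s + t <= 1.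
Proof.
move=> cK iE Ku Kv bd s0 t0; split; last first.
  by move=> st; apply: triangle_sub => //; [exact: interior_subset|exact: ltW..].
move=> Kx; rewrite leNgt; apply/negP => st1.
have st0 : 0 < s + t by lra.
have stn0 : s + t != 0 by rewrite gt_eqF.
have /(interior_star cK iE Kx) : 0 <= (s + t)^-1 < 1.
  by rewrite invr_ge0 (ltW st0) invf_lt1.
have -> : E + (s + t)^-1 *: (E + s *: u + t *: v - E) =
    E + u + (t / (s + t)) *: ((E + v) - (E + u)).
  by apply: plane_eq; rewrite /= /GRing.scale/=; field.
by apply: bd; rewrite divr_ge0 ?(ltW t0) ?(ltW st0)//= ler_pdivrMr//; lra.
Qed.

Definition cross u v : R := u.1 * v.2 - u.2 * v.1.

Lemma crossC u v : cross v u = - cross u v.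
Proof. by rewrite /cross; ring. Qed.

Lemma crossZ u v (k l : R) : cross (k *: u) (l *: v) = k * l * cross u v.
Proof. by rewrite /cross /= /GRing.scale/=; ring. Qed.

(** E divides each diagonal in proportion to the distances of the other two points
to it, which are measured by the orientations. *)
Lemma crossing_diagonals a b c d :
  orient a c b * orient a c d < 0 -> orient b d a * orient b d c < 0 ->
  exists E u v alpha beta, [/\ 0 < alpha, 0 < beta, cross u v != 0 &
    [/\ a = E + u, b = E + v, c = E - alpha *: u & d = E - beta *: v]].
Proof.
move=> PQ ST.
set P := orient a c b in PQ; set Q := orient a c d in PQ.
set S := orient b d a in ST; set T := orient b d c in ST.
have P0 : P != 0 by apply: contraTneq PQ => ->; rewrite mul0r ltxx.
have S0 : S != 0 by apply: contraTneq ST => ->; rewrite mul0r ltxx.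
have W0 : S - T != 0.
  by apply: contraTneq ST => /subr0_eq ->; rewrite -leNgt -expr2 sqr_ge0.
have PQST : P - Q = T - S by rewrite /P /Q /S /T /orient; ring.
pose E := a + (S / (S - T)) *: (c - a).
have EE : E = b + (- P / (S - T)) *: (d - b).
  apply: plane_eq; rewrite /E /= /GRing.scale/=.
  - apply: (mulIf W0); rewrite [LHS](_ : _ = a.1 * (S - T) + S * (c.1 - a.1));
      last by field.
    rewrite [RHS](_ : _ = b.1 * (S - T) - P * (d.1 - b.1)); last by field.
    by rewrite /P /S /T /orient; ring.
  - apply: (mulIf W0); rewrite [LHS](_ : _ = a.2 * (S - T) + S * (c.2 - a.2));
      last by field.
    rewrite [RHS](_ : _ = b.2 * (S - T) - P * (d.2 - b.2)); last by field.
    by rewrite /P /S /T /orient; ring.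
have quot_gt0 (x y : R) : x != 0 -> x * y < 0 -> 0 < - y / x.
  move=> x0 xy; have -> : - y / x = - (x * y) / x ^+ 2 by field.
  by rewrite divr_gt0// ?oppr_gt0// exprn_even_gt0.
exists E, (a - E), (b - E), (- T / S), (- Q / P); split.
- exact: quot_gt0.
- exact: quot_gt0.
- have -> : cross (a - E) (b - E) = - (S * P) / (S - T).
    have -> : a - E = (- S / (S - T)) *: (c - a).
      by apply: plane_eq; rewrite /E /= /GRing.scale/=; ring.
    have -> : b - E = (P / (S - T)) *: (d - b).
      by rewrite EE; apply: plane_eq; rewrite /= /GRing.scale/=; ring.
    apply: (mulIf W0); rewrite mulfVK// /cross /= /GRing.scale/=.
    transitivity (- (S * P) / (S - T) *
        ((c.1 - a.1) * (d.2 - b.2) - (c.2 - a.2) * (d.1 - b.1))); first by field.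
    have -> : (c.1 - a.1) * (d.2 - b.2) - (c.2 - a.2) * (d.1 - b.1) = S - T.
      by rewrite /S /T /orient; ring.
    by rewrite mulfVK.
  by rewrite mulf_neq0 ?invr_eq0// oppr_eq0 mulf_neq0.
split.
- by rewrite addrC subrK.
- by rewrite addrC subrK.
- by apply: plane_eq; rewrite /E /= /GRing.scale/=; field; rewrite W0.
- rewrite EE.
  have -> : Q = P + (S - T) by lra.
  by apply: plane_eq; rewrite /E /= /GRing.scale/=; field; rewrite W0.
Qed.
End Plane.

(** * Two area-bisecting chords of a convex set *)

Section Bisect.
Context {R : realType}.
Implicit Types (K : set (R * R)) (p q u v x y E : R * R).

Definition bisects p q K :=
  area (K `&` [set x | 0 < orient p q x]) =
  area (K `&` [set x | orient p q x < 0]).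

Lemma orient_affine p q x : orient p q x =
  (p.2 - q.2) * x.1 + (q.1 - p.1) * x.2 + (p.1 * q.2 - p.2 * q.1).
Proof. by rewrite /orient; ring. Qed.

Lemma measurable_orient_gt0 p q :
  measurable ([set x | 0 < orient p q x] : set (plane R)).
Proof.
by under eq_fun do rewrite orient_affine; exact: measurable_affine_gt0.
Qed.

Lemma orient_lt0E p q : [set x | orient p q x < 0] = [set x | 0 < orient q p x].
Proof. by apply/seteqP; split=> x /=; rewrite [orient q p x]orientC oppr_gt0. Qed.

Lemma measurable_orient_lt0 p q :
  measurable ([set x | orient p q x < 0] : set (plane R)).
Proof. by rewrite orient_lt0E; exact: measurable_orient_gt0. Qed.

(** The line itself has area zero. *)
Lemma area_split p q K : p != q -> measurable (K : set (plane R)) ->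
  area K = (area (K `&` [set x | (0 < orient p q x)%R]) +
            area (K `&` [set x | (orient p q x < 0)%R]))%E.
Proof.
move=> pq mK.
pose Z : set (plane R) := [set x | (p.2 - q.2) * x.1 + (q.1 - p.1) * x.2 +
  (p.1 * q.2 - p.2 * q.1) = 0].
have mZ : measurable Z by exact: measurable_affine_eq0.
have Z0 : area Z = 0.
  apply: area_line; apply: contra pq; rewrite paddr_eq0 ?sqr_ge0// !sqrf_eq0.
  rewrite !subr_eq0 => /andP[/eqP p2 /eqP p1]; apply/eqP.
  exact: plane_eq.
have mpos := measurable_orient_gt0 p q.
have mneg := measurable_orient_lt0 p q.
have KE : K = (K `&` [set x | 0 < orient p q x]) `|`
    (K `&` [set x | orient p q x < 0]) `|` (K `&` Z).
  apply/seteqP; split=> [x Kx|x [[[]|[]]|[]]//].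
  have [xn|xp|x0] := ltgtP (orient p q x) 0.
  - by left; right.
  - by left; left.
  - by right; split=> //; rewrite /Z/= -orient_affine.
have KZ0 : area (K `&` Z) = 0.
  apply/eqP; rewrite eq_le area_ge0 andbT -Z0.
  by apply: le_area => //; exact: measurableI.
rewrite [in LHS]KE area_setU ?KZ0 ?adde0.
- apply: area_setU; [exact: measurableI|exact: measurableI|].
  by rewrite -subset0; move=> x /= [[_ x1] [_]]; rewrite ltNge (ltW x1).
- by apply: measurableU; exact: measurableI.
- exact: measurableI.
- rewrite -subset0; move=> x /= [xpn [_]].
  by rewrite /Z/= -orient_affine => x0; case: xpn => -[_]; rewrite x0 ltxx.
Qed.

(** The letters give the signs with respect to the two lines.  Subtracting the two
equations leaves pn - np = np - pn, which is where finiteness enters. *)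
Lemma opposite_quarters (pp pn np nn : \bar R) :
  pp \is a fin_num -> pn \is a fin_num -> np \is a fin_num -> nn \is a fin_num ->
  (pp + pn = np + nn)%E -> (pp + np = pn + nn)%E -> pn = np.
Proof.
case: pp pn np nn => [pp||] // [pn||] // [np||] // [nn||] // _ _ _ _.
by rewrite -!EFinD => -[e1] [e2]; congr EFin; lra.
Qed.

Lemma bisects_opposite p q u v K : p != q -> u != v -> measurable (K : set (plane R)) ->
  (area K < +oo)%E -> bisects p q K -> bisects u v K ->
  area (K `&` [set x | 0 < orient p q x] `&` [set x | orient u v x < 0]) =
  area (K `&` [set x | orient p q x < 0] `&` [set x | 0 < orient u v x]).
Proof.
move=> pq uv mK Koo.
have mpp := measurable_orient_gt0 p q; have mpn := measurable_orient_lt0 p q.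
have mup := measurable_orient_gt0 u v; have mun := measurable_orient_lt0 u v.
have fin (A : set (plane R)) : measurable A -> A `<=` K -> area A \is a fin_num.
  move=> mA AK; rewrite ge0_fin_numE; last exact: area_ge0.
  by apply: le_lt_trans Koo; exact: le_area.
rewrite /bisects.
have mKpp := measurableI _ _ mK mpp; have mKpn := measurableI _ _ mK mpn.
have mKup := measurableI _ _ mK mup; have mKun := measurableI _ _ mK mun.
rewrite (area_split uv mKpp) (area_split uv mKpn).
rewrite (area_split pq mKup) (area_split pq mKun).
rewrite ![_ `&` [set x | 0 < orient u v x] `&` _]setIAC.
rewrite ![_ `&` [set x | orient u v x < 0] `&` _]setIAC.
have sub (A B : set (plane R)) : K `&` A `&` B `<=` K by move=> x [[]].
have f1 := fin _ (measurableI _ _ mKpp mup) (@sub _ _).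
have f2 := fin _ (measurableI _ _ mKpp mun) (@sub _ _).
have f3 := fin _ (measurableI _ _ mKpn mup) (@sub _ _).
have f4 := fin _ (measurableI _ _ mKpn mun) (@sub _ _).
exact: opposite_quarters f1 f2 f3 f4.
Qed.

(** The coefficient along u of x in the affine frame (E, u, v). *)
Definition coord E u v x : R := cross v (x - E) / cross v u.

Lemma coordP E u v x : cross u v != 0 ->
  x = E + coord E u v x *: u + coord E v u x *: v.
Proof.
rewrite /coord [cross v u]crossC /cross => D0.
by apply: plane_eq; rewrite /= /GRing.scale/=; field.
Qed.

(** The line through two points of E + R u is a coordinate axis, so the side of it
is given by the other coordinate. *)
Lemma orient_through E u v k x : cross u v != 0 ->
  orient (E + u) (E + k *: u) x = (k - 1) * (cross u v * coord E v u x).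
Proof.
move=> D0; rewrite /coord [cross u v * _]mulrC mulfVK//.
by rewrite /orient /cross /= /GRing.scale/=; ring.
Qed.

(** The triangle with vertices E, E + u, E + v; taking out the two sides at E and
keeping the third makes it equal to a piece of a convex set
([convex_quadrant]). *)
Definition corner E u v :=
  [set x | [/\ 0 < coord E u v x, 0 < coord E v u x &
               coord E u v x + coord E v u x <= 1]].

Definition unit_corner : set (R * R) := [set x | [/\ 0 < x.1, 0 < x.2 & x.1 + x.2 <= 1]].

Lemma measurable_unit_corner : measurable (unit_corner : set (plane R)).
Proof.
pose H (p q r : R) : set (plane R) := [set x | 0 < p * x.1 + q * x.2 + r].
have -> : unit_corner = H 1 0 0 `&` (H 0 1 0 `&` ~` H 1 1 (- 1)).
  apply/seteqP; rewrite /H; split=> x /=.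
    by move=> [x1 x2 x12]; split; [lra|split; [lra|apply/negP; rewrite -leNgt; lra]].
  by move=> [x1 [x2 /negP]]; rewrite -leNgt => x12; split; lra.
apply: measurableI; first exact: measurable_affine_gt0.
apply: measurableI; first exact: measurable_affine_gt0.
by apply: measurableC; exact: measurable_affine_gt0.
Qed.

Lemma area_unit_corner : exists2 r : R, 0 < r & area unit_corner = r%:E.
Proof.
have fin : (area unit_corner < +oo)%E.
  apply: (@area_bounded _ _ 2); first exact: measurable_unit_corner.
  by move=> x [x1 x2 x12]; rewrite !gtr0_norm//; lra.
have pos : (0 < area unit_corner)%E.
  apply: (@area_gt0 _ _ (4^-1, 4^-1)); first exact: measurable_unit_corner.
  apply/nbhs_boxP; exists 4^-1; first by rewrite invr_gt0.
  by move=> y /=; rewrite !ltr_norml => y1 y2; split; lra.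
exists (fine (area unit_corner)); last by rewrite fineK// gt0_fin_numE.
by rewrite fine_gt0// pos fin.
Qed.

(** The frame coordinates form an affine map of determinant 1 / cross u v from the
triangle onto the unit one. *)
Lemma area_corner E u v : cross u v != 0 ->
  area (corner E u v) = (`|cross u v|%:E * area unit_corner)%E.
Proof.
move=> D0.
have crossV : v.2 / cross u v * (u.1 / cross u v) -
    - v.1 / cross u v * (- u.2 / cross u v) = (cross u v)^-1.
  by move: D0; rewrite /cross => D0; field.
have := area_affine (R := R) (m11 := v.2 / cross u v) (m12 := - v.1 / cross u v)
  ((v.1 * E.2 - v.2 * E.1) / cross u v) (m21 := - u.2 / cross u v)
  (m22 := u.1 / cross u v) ((u.2 * E.1 - u.1 * E.2) / cross u v) _ measurable_unit_corner.
rewrite crossV invr_eq0 normfV invrK => /(_ D0) <-.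
congr area; apply/seteqP; rewrite /corner/unit_corner; split=> x /=;
  by congr [/\ _, _ & _]; rewrite /coord ?[cross v u]crossC; move: D0; rewrite /cross => D0;
     (congr (_ < _) || congr (_ <= _)); rewrite /=; field.
Qed.

Definition quadrant E u v := [set x | 0 < coord E u v x /\ 0 < coord E v u x].

Lemma convex_quadrant K E u v : convex_in_plane K -> interior K E ->
  cross u v != 0 -> K (E + u) -> K (E + v) ->
  (forall r, 0 <= r <= 1 -> ~ interior K (E + u + r *: ((E + v) - (E + u)))) ->
  K `&` quadrant E u v = corner E u v.
Proof.
move=> cK iE D0 Ku Kv bd; apply/seteqP; split=> x.
- move=> [Kx [ux vx]]; split=> //.
  by apply/(convex_wedge cK iE Ku Kv bd) => //; rewrite -coordP.
- move=> [ux vx uvx]; split=> //.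
  by rewrite (coordP E x D0); apply/(convex_wedge cK iE Ku Kv bd).
Qed.

Lemma coordZ E u v (k l : R) x : k != 0 -> l != 0 ->
  coord E (k *: u) (l *: v) x = k^-1 * coord E u v x.
Proof.
move=> k0 l0; rewrite /coord crossZ.
have -> : cross (l *: v) (x - E) = l * cross v (x - E).
  by rewrite /cross /= /GRing.scale/=; ring.
have [->|vu0] := eqVneq (cross v u) 0; first by rewrite mulr0 invr0 !mulr0.
by field; rewrite k0 l0 vu0.
Qed.

Lemma chord_neq E u v k : k < 1 -> cross u v != 0 -> E + u != E + k *: u.
Proof.
move=> k1; apply: contraNneq => /addrI uk.
have := crossZ u v k 1; rewrite scale1r -uk mulr1 => /eqP.
rewrite -[X in X == _]mul1r -subr_eq0 -mulrBl mulf_eq0 subr_eq0 => /orP[|//].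
by rewrite gt_eqF.
Qed.

(** The sectors facing ab and cd have equal areas, and they are triangles whose
areas are proportional to cross u v and alpha beta (cross u v). *)
Lemma bisecting_chords K E u v alpha beta : convex_in_plane K ->
  measurable (K : set (plane R)) -> (area K < +oo)%E -> interior K E ->
  cross u v != 0 -> 0 < alpha -> 0 < beta ->
  let a := E + u in let b := E + v in
  let c := E + (- alpha) *: u in let d := E + (- beta) *: v in
  K a -> K b -> K c -> K d ->
  (forall t, 0 <= t <= 1 -> ~ interior K (a + t *: (b - a))) ->
  (forall t, 0 <= t <= 1 -> ~ interior K (c + t *: (d - c))) ->
  bisects a c K -> bisects b d K -> alpha * beta = 1.
Proof.
move=> cK mK Koo iE D0 al0 be0 a b c d Ka Kb Kc Kd bdab bdcd biac bibd.
have aln0 : - alpha != 0 by rewrite oppr_eq0 gt_eqF.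
have ben0 : - beta != 0 by rewrite oppr_eq0 gt_eqF.
have D0' : cross v u != 0 by rewrite crossC oppr_eq0.
have DZ : cross (- alpha *: u) (- beta *: v) = alpha * beta * cross u v.
  by rewrite crossZ mulrNN.
have al1 : - alpha - 1 < 0 by lra.
have be1 : - beta - 1 < 0 by lra.
have acn0 : a != c by apply: (chord_neq E _ D0); lra.
have bdn0 : b != d by apply: (chord_neq E _ D0'); lra.
have acpos x : (0 < orient a c x) = (cross u v * coord E v u x < 0).
  by rewrite (orient_through E _ x D0) nmulr_rgt0.
have acneg x : (orient a c x < 0) = (0 < cross u v * coord E v u x).
  by rewrite (orient_through E _ x D0) nmulr_rlt0.
have bdpos x : (0 < orient b d x) = (0 < cross u v * coord E u v x).
  by rewrite (orient_through E _ x D0') nmulr_rgt0// [cross v u]crossC mulNr oppr_lt0.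
have bdneg x : (orient b d x < 0) = (cross u v * coord E u v x < 0).
  by rewrite (orient_through E _ x D0') nmulr_rlt0// [cross v u]crossC mulNr oppr_gt0.
have quadZ : quadrant E (- alpha *: u) (- beta *: v) =
    [set x | coord E u v x < 0 /\ coord E v u x < 0].
  rewrite /quadrant; under eq_fun do rewrite !coordZ// !nmulr_rgt0 ?invr_lt0 ?oppr_lt0//.
  by [].
have corner_ab : K `&` quadrant E u v = corner E u v.
  exact: convex_quadrant.
have DZ0 : cross (- alpha *: u) (- beta *: v) != 0.
  by rewrite crossZ mulf_neq0// mulf_neq0.
have corner_cd : K `&` quadrant E (- alpha *: u) (- beta *: v) =
    corner E (- alpha *: u) (- beta *: v).
  exact: convex_quadrant.
have : area (corner E u v) = area (corner E (- alpha *: u) (- beta *: v)).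
  rewrite -corner_ab -corner_cd quadZ /quadrant.
  have := bisects_opposite acn0 bdn0 mK Koo biac bibd; rewrite -!setIA.
  (* The sign of cross u v decides which of the two sectors lies on the positive
     side of ac. *)
  have [Dneg|Dpos] : cross u v < 0 \/ 0 < cross u v by apply/orP; rewrite -neq_lt.
  - rewrite [X in area (_ `&` X) = _](_ : _ =
      [set x | 0 < coord E u v x /\ 0 < coord E v u x]); last first.
      by apply/seteqP; split=> x /=; rewrite acpos bdneg !(nmulr_rlt0 _ Dneg) => -[].
    rewrite [X in _ = area (_ `&` X)](_ : _ =
      [set x | coord E u v x < 0 /\ coord E v u x < 0])//.
    by apply/seteqP; split=> x /=; rewrite acneg bdpos !(nmulr_rgt0 _ Dneg) => -[].
  - rewrite [X in area (_ `&` X) = _](_ : _ =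
      [set x | coord E u v x < 0 /\ coord E v u x < 0]); last first.
      by apply/seteqP; split=> x /=; rewrite acpos bdneg !(pmulr_rlt0 _ Dpos) => -[].
    rewrite [X in _ = area (_ `&` X)](_ : _ =
      [set x | 0 < coord E u v x /\ 0 < coord E v u x])//.
    by apply/seteqP; split=> x /=; rewrite acneg bdpos !(pmulr_rgt0 _ Dpos) => -[].
rewrite (area_corner E D0) (area_corner E DZ0) DZ.
rewrite normrM gtr0_norm ?mulr_gt0//.
have [r r0 ->] := area_unit_corner; rewrite -!EFinM => -[].
rewrite -mulrA -[LHS]mul1r => /mulIf ->//.
by rewrite mulf_neq0 ?normr_eq0// gt_eqF.
Qed.
End Bisect.

(** * Indices modulo 2n *)

Section Index.
Variable n : nat.
Hypothesis n_gt1 : (1 < n)%N.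
Implicit Types i j : 'Z_(2 * n).

Let n2_gt1 : (1 < 2 * n)%N.
Proof. by rewrite mul2n -addnn ltn_addl. Qed.

Lemma index_shift_inj i k m : (k < 2 * n)%N -> (m < 2 * n)%N ->
  i + k%:R = i + m%:R -> k = m.
Proof.
move=> kn mn /addrI /(congr1 val) /=.
by rewrite !val_Zp_nat// !modn_small.
Qed.

Lemma index_shift_surj i j : exists2 m, (m < 2 * n)%N & j = i + m%:R.
Proof.
exists (val (j - i)); last by rewrite natr_Zp addrC subrK.
by apply: leq_trans (ltn_ord _) _; rewrite Zp_cast.
Qed.

Lemma index_period : n%:R + n%:R = 0 :> 'Z_(2 * n).
Proof. by rewrite -natrD addnn -mul2n pchar_Zp. Qed.

Lemma odd_succ i : odd (i + 1)%R = ~~ odd i.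
Proof.
have -> : i + 1 = (i.+1)%:R by rewrite -[in LHS](natr_Zp i) -natr1.
by rewrite val_Zp_nat// odd_mod ?mul2n ?odd_double.
Qed.
End Index.

(** * The region bounded by a polygon *)

Section Region.
Context {R : realType} {n : nat}.
Variable gamma : 'Z_(2 * n) -> R * R.
Local Notation K := (region gamma).

Lemma region_convex : convex_in_plane K.
Proof.
move=> _ _ t [w [w0 w1 ->]] [w' [w'0 w'1 ->]] /andP[t0 t1].
exists (fun i => (1 - t) * w i + t * w' i); split.
- by move=> i; rewrite addr_ge0// mulr_ge0// subr_ge0.
- by rewrite big_split/= -!mulr_sumr w1 w'1; ring.
- rewrite -sumrB scaler_sumr -big_split/=; apply: eq_bigr => i _.
  by apply: plane_eq; rewrite /= /GRing.scale/=; ring.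
Qed.

Lemma vertex_region i : K (gamma i).
Proof.
exists (fun j => (j == i)%:R); split.
- by move=> j; case: eqP.
- by rewrite (bigD1 i)//= eqxx big1 ?addr0// => j /negbTE ->.
- rewrite (bigD1 i)//= eqxx scale1r big1 ?addr0// => j /negbTE ->.
  by rewrite scale0r.
Qed.

Lemma region_orient_ge0 p q : (forall i, 0 <= orient p q (gamma i)) ->
  forall x, K x -> 0 <= orient p q x.
Proof.
move=> H _ [w [w0 w1 ->]].
have -> : orient p q (\sum_i w i *: gamma i) = \sum_i w i * orient p q (gamma i).
  rewrite orient_affine.
  under [RHS]eq_bigr do rewrite orient_affine 2!mulrDr.
  rewrite !big_split/= -mulr_suml w1 mul1r (raddf_sum (@fst R R)) (raddf_sum (@snd R R))/=.
  by rewrite !mulr_sumr; congr (_ + _ + _); apply: eq_bigr => i _; exact: mulrCA.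
by apply: sumr_ge0 => i _; rewrite mulr_ge0.
Qed.

Lemma region_bounded : exists M, forall x, K x -> `|x.1| < M /\ `|x.2| < M.
Proof.
pose M := \sum_i (`|(gamma i).1| + `|(gamma i).2|).
have bd i : `|(gamma i).1| <= M /\ `|(gamma i).2| <= M.
  have M' : `|(gamma i).1| + `|(gamma i).2| <= M.
    by rewrite /M (bigD1 i)//= lerDl sumr_ge0// => j _; rewrite addr_ge0.
  by have := normr_ge0 (gamma i).1; have := normr_ge0 (gamma i).2; lra.
exists (M + 1) => _ [w [w0 w1 ->]].
have wM (f : 'Z_(2 * n) -> R) : (forall i, `|f i| <= M) ->
    `|\sum_i w i * f i| < M + 1.
  move=> fM; apply: le_lt_trans (_ : M < _); last by rewrite ltrDl.
  rewrite (le_trans (ler_norm_sum _ _ _))//.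
  rewrite -[leRHS]mul1r -w1 mulr_suml ler_sum// => i _.
  by rewrite normrM ger0_norm// ler_wpM2l.
rewrite (raddf_sum (@fst R R)) (raddf_sum (@snd R R))/=; split; apply: wM => i;
  by have [] := bd i.
Qed.

Hypothesis boundaryE :
  boundary K = \bigcup_i side (gamma i) (gamma (i + 1)).

Lemma side_region i t : 0 <= t <= 1 ->
  K (gamma i + t *: (gamma (i + 1) - gamma i)).
Proof. by move=> t01; apply: region_convex => //; exact: vertex_region. Qed.

Lemma side_not_interior i t : 0 <= t <= 1 ->
  ~ interior K (gamma i + t *: (gamma (i + 1) - gamma i)).
Proof.
move=> t01.
have : boundary K (gamma i + t *: (gamma (i + 1) - gamma i)).
  by rewrite boundaryE; exists i => //; exists t; rewrite //= in_itv.
by case.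
Qed.

(** A point of the closure is interior or on the boundary, and the boundary
consists of sides, which lie in the convex hull of the vertices. *)
Lemma region_closed : closed K.
Proof.
move=> x Kx; have [/interior_subset//|ix] := pselect (interior K x).
have : boundary K x by [].
by rewrite boundaryE => -[i _ [t /=]]; rewrite in_itv/= => t01 <-; exact: side_region.
Qed.

Lemma region_measurable : measurable (K : set (plane R)).
Proof.
rewrite -(setCK K); apply: measurableC; apply: open_measurable2.
by rewrite openC; exact: region_closed.
Qed.

Lemma region_finite : (area K < +oo)%E.
Proof.
have [M KM] := region_bounded; apply: area_bounded KM; exact: region_measurable.
Qed.

End Region.

(** * Chords of a half-area polygon *)

(** Having the same strict sign is transitive. *)
Lemma mulr_gt0_trans (R : realType) (x y z : R) : 0 < x * y -> 0 < y * z -> 0 < x * z.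
Proof.
move=> xy yz; have y2 : 0 < y ^+ 2.
  by rewrite exprn_even_gt0//=; apply: contraTneq xy => ->; rewrite mulr0 ltxx.
rewrite -(pmulr_rgt0 _ y2) [X in _ < X](_ : _ = x * y * (y * z)); last by ring.
exact: mulr_gt0.
Qed.

Section HalfArea.
Context {R : realType} {n : nat}.
Hypothesis n_gt1 : (1 < n)%N.
Variable gamma : 'Z_(2 * n) -> R * R.
Hypothesis hgamma : half_area_polygon gamma.
Local Notation K := (region gamma).
Local Notation opp i := (i + n%:R).

Let gamma_inj : injective gamma. Proof. by case: hgamma => -[]. Qed.
Let intK : interior K !=set0. Proof. by case: hgamma => -[]. Qed.
Let bdK : boundary K = \bigcup_i side (gamma i) (gamma (i + 1)).
Proof. by case: hgamma => -[]. Qed.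
Let sidesD i j : i != j ->
  half_open_side (gamma i) (gamma (i + 1)) `&`
  half_open_side (gamma j) (gamma (j + 1)) = set0.
Proof. by case: hgamma => -[_ _ _ + _]; exact. Qed.
Let halves i : bisects (gamma i) (gamma (opp i)) K.
Proof. by case: hgamma => _; exact. Qed.
Let cK : convex_in_plane K := @region_convex R n gamma.
Let n2 : (n < 2 * n)%N. Proof. by lia. Qed.

Implicit Types i k : 'Z_(2 * n).

Lemma shift_neq i (k m : nat) : (k < 2 * n)%N -> (m < 2 * n)%N -> k != m ->
  i + k%:R != i + m%:R :> 'Z_(2 * n).
Proof. by move=> kn mn; apply: contra => /eqP/index_shift_inj->. Qed.

Lemma opp_opp i : opp (opp i) = i.
Proof. by rewrite -addrA index_period// addr0. Qed.

Lemma opp_neq i : gamma i != gamma (opp i).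
Proof.
apply/eqP => /gamma_inj; rewrite -[LHS]addr0 => /(@index_shift_inj n n_gt1 i 0%N n).
by rewrite (ltn_trans (ltnW n_gt1) n2) n2 => /(_ isT isT) n0; move: n_gt1; rewrite -n0.
Qed.

Lemma vertex_not_interior i : ~ interior K (gamma i).
Proof.
have := @side_not_interior R n gamma bdK i 0.
by rewrite scale0r addr0; apply; rewrite lexx ler01.
Qed.

(** If one side were empty both halves would have area zero, but the region has
interior points. *)
Lemma both_sides i :
  (exists2 p, K p & 0 < orient (gamma i) (gamma (opp i)) p) /\
  (exists2 q, K q & orient (gamma i) (gamma (opp i)) q < 0).
Proof.
have mK := region_measurable bdK.
have areaK := area_split (opp_neq i) mK.
have [x0 ix0] := intK.
have K0 : (0 < area K)%E by exact: (@area_gt0 _ _ x0).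
have nonempty (P : set (R * R)) : area (K `&` P) != 0%E -> exists2 p, K p & P p.
  move=> KP; apply: contrapT => noP; move/eqP: KP; apply.
  rewrite [X in area X](_ : _ = set0) ?area0//.
  by rewrite -subset0 => x [Kx Px]; apply: noP; exists x.
have h := halves i; rewrite /bisects in h.
split; apply: nonempty; apply: contraTneq K0 => A0; rewrite areaK.
  by rewrite -h A0 adde0 ltxx.
by rewrite h A0 adde0 ltxx.
Qed.

Lemma boundary_chord i y : K y -> ~ interior K y ->
  orient (gamma i) (gamma (opp i)) y = 0 -> y = gamma i \/ y = gamma (opp i).
Proof.
move=> Ky iy oy; have [[p Kp op] [q Kq oq]] := both_sides i.
apply: (interior_collinear_middle (K := K) (p := p) (q := q)) => //;
  by [exact: opp_neq | exact: vertex_region | exact: vertex_not_interior].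
Qed.

(** gamma i starts the half-open side number i, which is disjoint from the others. *)
Lemma vertex_off_side i k t : k != i -> 0 < t < 1 ->
  gamma k + t *: (gamma (k + 1) - gamma k) <> gamma i.
Proof.
move=> ki /andP[t0 t1] e; have /seteqP[+ _] := sidesD ki.
move=> /(_ (gamma i)); apply; split.
  by exists t => //=; rewrite in_itv/= (ltW t0).
by exists 0; rewrite /= ?in_itv/= ?lexx ?ltr01// scale0r addr0.
Qed.

Lemma orient_vertex_neq0 i k : k != i -> k != opp i ->
  orient (gamma i) (gamma (opp i)) (gamma k) != 0.
Proof.
move=> ki koi; apply/eqP => /boundary_chord.
by case=> [||/gamma_inj/eqP|/gamma_inj/eqP]; [exact: vertex_region|
  exact: vertex_not_interior|exact/negP|exact/negP].
Qed.

(** A side whose endpoints were strictly separated by the chord would cross it at a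
boundary point, thus at an end of the chord, which lies only on the two sides
that meet there. *)
Lemma side_same_side i k : k != i -> k != opp i -> k + 1 != i -> k + 1 != opp i ->
  0 < orient (gamma i) (gamma (opp i)) (gamma k) *
      orient (gamma i) (gamma (opp i)) (gamma (k + 1)).
Proof.
move=> ki koi k1i k1oi.
set f := orient _ _; rewrite lt0r mulf_neq0 ?orient_vertex_neq0//=.
rewrite leNgt; apply/negP => fneg.
pose t := f (gamma k) / (f (gamma k) - f (gamma (k + 1))).
have fk0 : f (gamma k) != 0 by exact: orient_vertex_neq0.
have D0 : f (gamma k) - f (gamma (k + 1)) != 0.
  by apply: contraTneq fneg => /subr0_eq ->; rewrite -leNgt -expr2 sqr_ge0.
have t01 : 0 < t < 1.
  have [fp|fn] : 0 < f (gamma k) \/ f (gamma k) < 0.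
    by apply/orP; rewrite -neq_lt eq_sym.
  - have f1 : f (gamma (k + 1)) < 0 by rewrite -(pmulr_rlt0 _ fp).
    have D1 : 0 < f (gamma k) - f (gamma (k + 1)) by lra.
    by rewrite /t divr_gt0//= ltr_pdivrMr//; lra.
  - have f1 : 0 < f (gamma (k + 1)) by rewrite -(nmulr_rlt0 _ fn).
    have D1 : f (gamma k) - f (gamma (k + 1)) < 0 by lra.
    by rewrite /t nmulr_rgt0 ?invr_lt0 ?D1//= ltr_ndivrMr//; lra.
have t01' : 0 <= t <= 1 by case/andP: t01 => /ltW -> /ltW ->.
have : f (gamma k + t *: (gamma (k + 1) - gamma k)) = 0.
  transitivity ((1 - t) * f (gamma k) + t * f (gamma (k + 1))).
    by rewrite /f /orient /= /GRing.scale/=; ring.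
  by rewrite /t; field.
move=> /boundary_chord[||/vertex_off_side|/vertex_off_side]; last 2 first.
- exact.
- exact.
- exact: side_region.
- exact: side_not_interior.
Qed.

(** Its sign tells the side of the line l(i). *)
Let chord_side i := orient (gamma i) (gamma (opp i)).

Lemma chord_side_opp i x : chord_side (opp i) x = - chord_side i x.
Proof. by rewrite /chord_side opp_opp orientC. Qed.

(** The sides joining the vertices strictly between the two ends of a chord never
cross that chord. *)
Lemma arc_same_side i m : (0 < m < n)%N ->
  0 < chord_side i (gamma (i + 1)) * chord_side i (gamma (i + m%:R)).
Proof.
elim: m => // -[_ _|m IH /andP[_ mn]].
  rewrite -expr2 exprn_even_gt0//= orient_vertex_neq0//.
    by rewrite -[X in _ != X]addr0 (@shift_neq i 1 0)//; lia.
  by rewrite (@shift_neq i 1 n)//; lia.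
have {}IH : 0 < chord_side i (gamma (i + 1)) * chord_side i (gamma (i + m.+1%:R)).
  by apply: IH; lia.
have side : 0 < chord_side i (gamma (i + m.+1%:R)) * chord_side i (gamma (i + m.+2%:R)).
  have -> : i + m.+2%:R = i + m.+1%:R + 1 by rewrite -addrA natr1.
  apply: side_same_side.
  - by rewrite -[X in _ != X]addr0 (@shift_neq i m.+1 0)//; lia.
  - by rewrite (@shift_neq i m.+1 n)//; lia.
  - by rewrite -addrA natr1 -[X in _ != X]addr0 (@shift_neq i m.+2 0)//; lia.
  - by rewrite -addrA natr1 (@shift_neq i m.+2 n)//; lia.
exact: mulr_gt0_trans IH side.
Qed.

(** Each of the two arcs lies on one side of the chord.  If it were the same side,
all vertices, hence the whole region, would lie there. *)
Lemma neighbours_opposite i :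
  chord_side i (gamma (i + 1)) * chord_side i (gamma (opp i + 1)) < 0.
Proof.
have fi0 : chord_side i (gamma i) = 0 by rewrite /chord_side /orient; ring.
have foi0 : chord_side i (gamma (opp i)) = 0 by rewrite /chord_side /orient; ring.
have s0 : chord_side i (gamma (i + 1)) != 0.
  apply: orient_vertex_neq0.
    by rewrite -[X in _ != X]addr0 (@shift_neq i 1 0)//; lia.
  by rewrite (@shift_neq i 1 n)//; lia.
have so0 : chord_side i (gamma (opp i + 1)) != 0.
  apply: orient_vertex_neq0.
    by rewrite -addrA natr1 -[X in _ != X]addr0 (@shift_neq i n.+1 0)//; lia.
  by rewrite -addrA natr1 (@shift_neq i n.+1 n)//; lia.
rewrite ltNge; apply/negP; rewrite le_eqVlt eq_sym mulf_eq0 (negbTE s0) (negbTE so0)/=.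
move=> same.
have all_same j : 0 <= chord_side i (gamma (i + 1)) * chord_side i (gamma j).
  have [m mn ->] := index_shift_surj n_gt1 i j.
  have [->|m0] := eqVneq m 0%N; first by rewrite addr0 fi0 mulr0.
  have [->|mn'] := eqVneq m n; first by rewrite foi0 mulr0.
  have [mltn|nltm] := ltnP m n; first by apply/ltW/arc_same_side; lia.
  have := @arc_same_side (opp i) (m - n).
  have -> : opp i + (m - n)%:R = i + m%:R by rewrite -addrA -natrD subnKC.
  rewrite !chord_side_opp mulrNN => far.
  by apply/ltW/(mulr_gt0_trans same)/far; lia.
have [[p Kp op] [q Kq oq]] := both_sides i.
have [sp|sn] : 0 < chord_side i (gamma (i + 1)) \/ chord_side i (gamma (i + 1)) < 0.
  by apply/orP; rewrite -neq_lt eq_sym.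
- have /region_orient_ge0 /(_ q Kq) : forall j, 0 <= chord_side i (gamma j).
    by move=> j; rewrite -(pmulr_rge0 _ sp); exact: all_same.
  by rewrite leNgt oq.
- have /region_orient_ge0 /(_ p Kp) : forall j, 0 <= orient (gamma (opp i)) (gamma i) (gamma j).
    by move=> j; rewrite orientC oppr_ge0 -(nmulr_rge0 _ sn); exact: all_same.
  by rewrite orientC oppr_ge0 leNgt op.
Qed.

Lemma opp_succ i : opp (i + 1) = opp i + 1.
Proof. by rewrite addrAC. Qed.

Lemma succ_pred i : i + 1 + (n - 1)%:R = opp i.
Proof. by rewrite -addrA nat1r subn1 prednK// ltnW. Qed.

(** gamma i and its opposite vertex are the last vertices of the two arcs cut out by
l(i + 1), whose first vertices are separated by that line. *)
Lemma ends_opposite i :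
  chord_side (i + 1) (gamma i) * chord_side (i + 1) (gamma (opp i)) < 0.
Proof.
have n1 : (0 < n - 1 < n)%N by lia.
have near_opp := @arc_same_side (i + 1) (n - 1) n1.
have near_i := @arc_same_side (opp (i + 1)) (n - 1) n1.
have opposite := neighbours_opposite (i + 1).
rewrite succ_pred in near_opp.
rewrite !chord_side_opp mulrNN opp_succ succ_pred opp_opp in near_i.
rewrite opp_succ in opposite.
move: near_opp near_i opposite.
set x := chord_side _ (gamma (i + 1 + 1)); set y := chord_side _ (gamma (opp i + 1 + 1)).
set z := chord_side _ (gamma (opp i)); set w := chord_side _ (gamma i).
move=> xz yw xy; rewrite ltNge; apply/negP => wz.
have w0 : w != 0 by apply: contraTneq yw => ->; rewrite mulr0 ltxx.
have z0 : z != 0 by apply: contraTneq xz => ->; rewrite mulr0 ltxx.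
have {}wz : 0 < w * z by rewrite lt_def mulf_neq0.
have := mulr_gt0_trans xz (_ : 0 < z * w); rewrite mulrC => /(_ wz) xw.
have := mulr_gt0_trans xw (_ : 0 < w * y); rewrite mulrC => /(_ yw).
by rewrite ltNge ltW.
Qed.

(** The coefficients alpha and 1 / alpha make the segments from gamma (i + 1) to
gamma (i + n) and from gamma i to gamma (i + n + 1) parallel. *)
Lemma trapezoid i : exists E u v alpha, [/\ 0 < alpha, cross u v != 0,
  gamma i = E + u /\ gamma (opp i) = E + (- alpha) *: u &
  gamma (i + 1) = E + v /\ gamma (opp i + 1) = E + (- alpha^-1) *: v].
Proof.
have := crossing_diagonals (neighbours_opposite i).
have := ends_opposite i; rewrite /chord_side opp_succ => ends /(_ ends).
move=> [E [u [v [alpha [beta [al0 be0 D0 [aE bE cE dE]]]]]]].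
exists E, u, v, alpha.
suff ab : alpha * beta = 1.
  have <- : beta = alpha^-1.
    by rewrite -[RHS]mulr1 -ab mulKf// gt_eqF.
  by rewrite !scaleNr; split.
have KV := vertex_region gamma.
have iE : interior K E.
  have EE : E = gamma i + (1 + alpha)^-1 *: (gamma (opp i) - gamma i).
    by rewrite aE cE; apply: plane_eq; rewrite /= /GRing.scale/=; field; lra.
  have t01 : 0 < (1 + alpha)^-1 < 1.
    by rewrite invr_gt0 invf_lt1; lra.
  rewrite EE.
  have := neighbours_opposite i; rewrite /chord_side.
  have [|xn|->] := ltgtP (orient (gamma i) (gamma (opp i)) (gamma (i + 1))) 0;
    last by rewrite mul0r ltxx.
    move=> xn; rewrite nmulr_rlt0// => yp.
    exact: (interior_middle cK (KV _) (KV _) (KV _) (KV _) yp xn).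
  rewrite pmulr_rlt0// => yn.
  exact: (interior_middle cK (KV _) (KV _) (KV _) (KV _) xn yn).
rewrite -!scaleNr in cE dE.
have mK := region_measurable bdK.
have cd : opp i + 1 = opp (i + 1) by rewrite opp_succ.
apply: (@bisecting_chords _ K E u v alpha beta cK mK (region_finite bdK) iE D0 al0 be0).
- by rewrite -aE.
- by rewrite -bE.
- by rewrite -cE.
- by rewrite -dE.
- by rewrite -aE -bE => t t01; exact: side_not_interior.
- by rewrite -cE -dE => t t01; exact: side_not_interior.
- by rewrite -aE -cE.
- by rewrite -bE -dE cd.
Qed.
End HalfArea.

(** * Diagonal ratios and the envelope *)

Lemma eucl_dist_eq0 (R : realType) (p q : R * R) : eucl_dist p q = 0 -> p = q.
Proof.
move=> /eqP; rewrite sqrtr_eq0 => le0.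
have /eqP : (p.1 - q.1) ^+ 2 + (p.2 - q.2) ^+ 2 = 0.
  by apply/eqP; rewrite eq_le le0 addr_ge0 ?sqr_ge0.
rewrite paddr_eq0 ?sqr_ge0// !sqrf_eq0 !subr_eq0 => /andP[/eqP ? /eqP ?].
exact: plane_eq.
Qed.

Lemma eucl_distZ (R : realType) (k : R) (p q p' q' : R * R) : 0 <= k ->
  p - q = k *: (p' - q') -> eucl_dist p q = k * eucl_dist p' q'.
Proof.
case: p q p' q' => [p1 p2] [q1 q2] [p1' p2'] [q1' q2'] k0 [e1 e2].
rewrite /eucl_dist/= e1 e2 -[X in X * _](ger0_norm k0) -sqrtr_sqr -sqrtrM ?sqr_ge0//.
by congr Num.sqrt; rewrite /GRing.scale/=; ring.
Qed.

Section Envelope.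
Context {R : realType} {n : nat}.
Hypothesis n_gt1 : (1 < n)%N.
Variable gamma : 'Z_(2 * n) -> R * R.
Hypothesis hgamma : half_area_polygon gamma.
Implicit Types i : 'Z_(2 * n).
Local Notation lam := (lambda gamma).

(** By [trapezoid], the diagonal from gamma (i + 1) to gamma (i + n) is the image of
the one from gamma (i + n + 1) to gamma i under the homothety of centre E and
ratio - alpha; so alpha is lambda.  The chords have independent directions, hence
E is their only common point. *)
Lemma chords_meet i : 0 < lam i /\ exists E,
  [/\ envelope_vertex gamma i = [set E],
      gamma (i + n%:R) - E = - lam i *: (gamma i - E),
      gamma (i + 1) - E = - lam i *: (gamma (i + n%:R + 1) - E) &
      gamma (i + 1) != E].
Proof.
have [E [u [v [alpha [al0 D0 [aE cE] [bE dE]]]]]] := trapezoid n_gt1 hgamma i.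
have aln0 : alpha != 0 by rewrite gt_eqF.
have succ_opp : i + 1 + n%:R = i + n%:R + 1 by rewrite addrAC.
have da : eucl_dist (gamma (i + n%:R + 1)) (gamma i) != 0.
  apply/eqP => /eucl_dist_eq0; rewrite dE aE => /addrI uv.
  by move: D0; rewrite -uv /cross /= /GRing.scale/= => /eqP; apply; ring.
have lamE : lam i = alpha.
  rewrite /lambda (@eucl_distZ R alpha _ _ (gamma (i + n%:R + 1)) (gamma i)).
  - by rewrite mulfK.
  - exact: ltW.
  - by rewrite bE cE dE aE; apply: plane_eq; rewrite /= /GRing.scale/=; field.
rewrite lamE; split=> //; exists E; split.
- apply/seteqP; split=> [x [[t _ tx] [s _ sx]]|_ ->].
    have xu : x - E = (1 - t * (1 + alpha)) *: u.
      by rewrite -tx aE cE; apply: plane_eq; rewrite /= /GRing.scale/=; ring.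
    have xv : x - E = (1 - s * (1 + alpha^-1)) *: v.
      rewrite -sx bE succ_opp dE.
      by apply: plane_eq; rewrite /= /GRing.scale/=; ring.
    have k0 : 1 - t * (1 + alpha) = 0.
      apply: (mulIf D0); rewrite mul0r.
      have := crossZ u v (1 - t * (1 + alpha)) 1; rewrite mulr1 scale1r => <-.
      by rewrite -xu xv /cross /= /GRing.scale/=; ring.
    by apply: subr0_eq; rewrite xu k0 scale0r.
  have al1 : 1 + alpha != 0 by rewrite gt_eqF// addr_gt0.
  split.
    exists (1 + alpha)^-1 => //; rewrite aE cE.
    by apply: plane_eq; rewrite /= /GRing.scale/=; field.
  exists (alpha / (1 + alpha)) => //; rewrite bE succ_opp dE.
  by apply: plane_eq; rewrite /= /GRing.scale/=; field; rewrite aln0 al1.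
- by rewrite aE cE; apply: plane_eq; rewrite /= /GRing.scale/=; ring.
- by rewrite bE dE; apply: plane_eq; rewrite /= /GRing.scale/=; field.
- apply: contraNneq D0; rewrite bE -[X in _ = X]addr0 => /addrI ->.
  by rewrite /cross /=; apply/eqP; ring.
Qed.

Lemma index_ind (P : 'Z_(2 * n) -> Prop) :
  P 0 -> (forall i, P i -> P (i + 1)) -> forall i, P i.
Proof.
move=> P0 PS i; rewrite -(natr_Zp i).
elim: (val i) => [|m IH]; first exact: P0.
by rewrite -natr1; exact: PS.
Qed.

(** Consecutive ratios being inverse to each other is what alternation between c
and 1 / c means; c is the ratio at the odd index 1. *)
Lemma odd_symmetricP : odd_symmetric gamma <-> forall i, lam i * lam (i + 1) = 1.
Proof.
have lam0 i : lam i != 0 by have [/gt_eqF->] := chords_meet i.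
split.
  move=> [c [c0 cE]] i; rewrite !cE odd_succ//.
  by case: (odd i); rewrite /= ?mulfV ?mulVf// gt_eqF.
move=> lamM; exists (lam 1); split; first by have [] := chords_meet 1.
have lam_succ i : lam (i + 1) = (lam i)^-1.
  by rewrite -[RHS]mulr1 -(lamM i) mulKf.
apply: index_ind => [|i IH].
  by rewrite /= -[1]add0r lam_succ invrK.
by rewrite lam_succ IH odd_succ//; case: (odd i); rewrite /= ?invrK.
Qed.

(** The chord from b = gamma (i + 1) to d = gamma (i + 1 + n) contains two envelope
vertices E and E', with b - E = - lambda i (d - E) and
d - E' = - lambda (i + 1) (b - E').  If E = E', substituting one equation in the
other gives lambda i lambda (i + 1) = 1, as b is not E; conversely, if the
ratios are inverse, both equations determine the same point. *)
Lemma envelope_is_pointP :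
  envelope_is_point gamma <-> forall i, lam i * lam (i + 1) = 1.
Proof.
have meet (k : R) (E p q : R * R) : 0 < k -> p - E = - k *: (q - E) ->
    E = (1 + k)^-1 *: (p + k *: q).
  move=> k0 e; have k1 : 1 + k != 0 by rewrite gt_eqF// addr_gt0.
  have -> : p = E - k *: (q - E) by rewrite -scaleNr -e addrC subrK.
  by apply: plane_eq; rewrite /= /GRing.scale/=; field.
split.
  move=> [C CE] i.
  have [_ [E [EE _ bd bE]]] := chords_meet i.
  have [_ [E' [EE' db _ _]]] := chords_meet (i + 1).
  have EC : E = C by have : [set E] E by []; rewrite -EE CE.
  have EC' : E' = C by have : [set E'] E' by []; rewrite -EE' CE.
  rewrite EC in bd bE; rewrite EC' addrAC in db.
  rewrite db scalerA mulrNN in bd.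
  have /eqP : (lam i * lam (i + 1) - 1) *: (gamma (i + 1) - C) = 0.
    by rewrite scalerBl scale1r -bd subrr.
  by rewrite scaler_eq0 !subr_eq0 (negbTE bE) orbF => /eqP.
move=> lamM.
have [_ [C [CE _ _ _]]] := chords_meet 0.
exists C; apply: index_ind => // i <-.
have [l0 [E [-> _ bd _]]] := chords_meet i.
have [l0' [E' [-> db _ _]]] := chords_meet (i + 1).
congr [set _]; rewrite (meet _ _ _ _ l0 bd) (meet _ _ _ _ l0' db).
rewrite [i + 1 + _]addrAC.
have -> : lam (i + 1) = (lam i)^-1.
  by rewrite -[RHS]mulr1 -(lamM i) mulKf// gt_eqF.
apply: plane_eq; rewrite /= /GRing.scale/=; field;
  by rewrite !gt_eqF ?addr_gt0.
Qed.
End Envelope.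

Theorem corollary4p2 (R : realType) (n : nat) (hn : (2 <= n)%N)
    (gamma : 'Z_(2 * n) -> R * R) (hgamma : half_area_polygon gamma) :
  odd_symmetric gamma <-> envelope_is_point gamma.
Proof.
exact: iff_trans (odd_symmetricP hn hgamma) (iff_sym (envelope_is_pointP hn hgamma)).
Qed.
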